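(* Let $\pi: Y\to X$ be a fibred manifold and $L$ a semiregular Lagrangian density on $J^1Y$, with Legendre morphism $\widehat L:J^1Y\to\Pi$ and constraint space $Q=\widehat L(J^1Y)\subset\Pi$. Then all Hamiltonian forms $H$ associated with $L$ coincide with each other on $Q$ (i.e. if $H=p^\lambda_i dy^i\wedge\omega_\lambda-\mathcal H\omega$ and $H'=p^\lambda_i dy^i\wedge\omega_\lambda-\mathcal H'\omega$ are both associated with $L$, then $\mathcal H|_Q=\mathcal H'|_Q$), and the Poincaré–Cartan form $$\Xi_L=\pi^\lambda_i\,dy^i\wedge\omega_\lambda-\pi^\lambda_i y^i_\lambda\,\omega+\mathcal L\,\omega$$ is the pullback by $\widehat L$ of any Hamiltonian form $H$ associated with $L$, that is, $$\pi^\lambda_i y^i_\lambda-\mathcal L=\mathcal H(x^\mu,y^i,\pi^\lambda_i).$$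
   Context: All manifolds are real, smooth, Hausdorff, second-countable, finite-dimensional and connected; maps are smooth. A fibred manifold is a surjective submersion $\pi:Y\to X$, $n=\dim X$, with fibred coordinates $(x^\lambda,y^i)$; its first order jet manifold $J^1Y$ has coordinates $(x^\lambda,y^i,y^i_\lambda)$. Put $\omega=dx^1\wedge\dots\wedge dx^n$, $\omega_\lambda=\partial_\lambda\rfloor\omega$. A (first order) Lagrangian density is a horizontal density $L=\mathcal L(x^\mu,y^i,y^i_\mu)\omega$ on $J^1Y\to X$; $\pi^\lambda_i=\partial\mathcal L/\partial y^i_\lambda$. The Legendre manifold is $\Pi=\bigwedge^nT^*X\otimes_Y TX\otimes_Y V^*Y$ with coordinates $(x^\lambda,y^i,p^\lambda_i)$. The Legendre morphism $\widehat L:J^1Y\to\Pi$ over $Y$ is $p^\lambda_i\circ\widehat L=\pi^\lambda_i$. $L$ is semiregular if for every $p\in Q=\widehat L(J^1Y)$ the preimage $\widehat L^{-1}(p)$ is a connected submanifold of $J^1Y$. A Hamiltonian form on $\Pi$ is an $n$-form $H=p^\lambda_i dy^i\wedge\omega_\lambda-p^\lambda_i\Gamma^i_\lambda\omega-\widetilde{\mathcal H}_\Gamma\omega=p^\lambda_i dy^i\wedge\omega_\lambda-\mathcal H\omega$, where $\Gamma$ is a connection on $Y\to X$ and $\widetilde{\mathcal H}_\Gamma\omega$ is a horizontal density on $\Pi\to X$. It defines the momentum morphism $\widehat H:\Pi\to J^1Y$ over $Y$, $y^i_\lambda\circ\widehat H=\partial\mathcal H/\partial p^\lambda_i$. For a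 fibred morphism $\Phi:\Pi\to J^1Y$ over $Y$ with $y^i_\lambda\circ\Phi=\Phi^i_\lambda$, put $H_\Phi=p^\lambda_i dy^i\wedge\omega_\lambda-p^\lambda_i\Phi^i_\lambda\omega$. $H$ is associated with $L$ if $\widehat L\circ\widehat H|_Q=\mathrm{Id}_Q$ and $H=H_{\widehat H}+L\circ\widehat H$ on $\Pi$, i.e. $\mathcal H=p^\lambda_i\,\partial\mathcal H/\partial p^\lambda_i-\mathcal L\circ\widehat H$. *)

(* Defs.v *)
From HB Require Import structures.
From mathcomp Require Import all_boot all_order all_algebra.
From mathcomp Require Import all_classical all_reals all_analysis.
Import Order.TTheory GRing.Theory Num.Theory.
Import numFieldNormedType.Exports.

Set Implicit Arguments.
Unset Strict Implicit.
Unset Printing Implicit Defensive.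

Local Open Scope classical_set_scope.
Local Open Scope ring_scope.

Section Smooth.
Context {R : realType} {E F : normedModType R}.

Fixpoint Ck (k : nat) (U : set E) (f : E -> F) : Prop :=
  match k with
  | 0 => forall x, U x -> {for x, continuous f}
  | k'.+1 => (forall x, U x -> differentiable f x) /\
             forall v : E, Ck k' U (fun x => 'd f x v)
  end.

(* C^infinity on U; meaningful only for U open, as derivatives at points of U
   see the values of f in a full neighbourhood *)
Definition smooth_on (U : set E) (f : E -> F) : Prop := forall k, Ck k U f.

End Smooth.

Section Charts.
Context {R : realType}.

Record chart (T : Type) (d : nat) :=
  Chart { dom : set T; crd : T -> 'rV[R]_d }.

(* f read in the chart a, i.e. f o a^-1 on a(dom a), and 0 elsewhere *)
Definition inchart (T : Type) (d : nat) (V : zmodType)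
    (a : chart T d) (f : T -> V) : 'rV[R]_d -> V :=
  fun w => xget 0 [set v | exists2 z, dom a z & crd a z = w /\ f z = v].

Definition is_chart (T : topologicalType) (d : nat) (a : chart T d) : Prop :=
  [/\ open (dom a),
      {in dom a &, injective (crd a)},
      (forall V : set 'rV[R]_d, open V -> open (dom a `&` crd a @^-1` V)) &
      (forall U : set T, open U -> U `<=` dom a -> open (crd a @` U))].

Definition compatible (T : Type) (d : nat) (a b : chart T d) : Prop :=
  smooth_on (crd a @` (dom a `&` dom b)) (inchart a (crd b)) /\
  smooth_on (crd b @` (dom a `&` dom b)) (inchart b (crd a)).

Record charted (d : nat) := Charted {
  carrier :> topologicalType;
  atlas : set (chart carrier d) }.

(* membership in the maximal atlas *)
Definition smooth_chart (d : nat) (M : charted d) (a : chart M d) : Prop :=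
  is_chart a /\ forall b, atlas b -> compatible a b.

Definition manifold (d : nat) (M : charted d) : Prop :=
  [/\ (forall a : chart M d, atlas a -> smooth_chart a),
      (forall z : M, exists2 a : chart M d, atlas a & dom a z),
      hausdorff_space M, @second_countable M & connected [set: M]].

Definition smooth_at (d e : nat) (M : charted d) (N : charted e)
    (f : M -> N) (z : M) : Prop :=
  exists (a : chart M d) (b : chart N e),
    [/\ smooth_chart a, smooth_chart b, dom a z,
        (forall w, dom a w -> dom b (f w)) &
        smooth_on (crd a @` dom a) (inchart a (fun w => crd b (f w)))].

Definition smooth_map (d e : nat) (M : charted d) (N : charted e)
    (f : M -> N) : Prop := forall z, smooth_at f z.

(* entry (l, k) is the derivative of the k-th coordinate of b with respect to
   the l-th coordinate of a *)
Definition jac (T : Type) (d : nat) (a b : chart T d) (z : T) : 'M[R]_d :=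
  'J (inchart a (crd b)) (crd a z).

Definition submanifold (d : nat) (M : charted d) (S : set M) : Prop :=
  exists2 k : nat, (k <= d)%N & forall z, S z ->
    exists a : chart M d, [/\ smooth_chart a, dom a z &
      forall w, dom a w ->
        (S w <-> forall j : 'I_d, (k <= j)%N -> crd a w 0 j = 0)].

(* The set T with the coarsest topology for which every chart in A has open
   domain and is continuous.  For the jet and Legendre bundles this is the usual
   manifold topology, the transition maps being homeomorphisms. *)
Definition glued (T : Type) (d : nat) (A : set (chart T d)) : Type := T.

Definition glued_subbase (T : Type) (d : nat) (A : set (chart T d)) :
    set (set T) :=
  [set U | exists2 a, A a &
     exists2 V : set 'rV[R]_d, open V & U = dom a `&` crd a @^-1` V].

End Charts.

HB.instance Definition _ (R : realType) (T : Type) (d : nat)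
  (A : set (@chart R T d)) := gen_eqMixin (glued A).
HB.instance Definition _ (R : realType) (T : Type) (d : nat)
  (A : set (@chart R T d)) := gen_choiceMixin (glued A).
HB.instance Definition _ (R : realType) (T : Type) (d : nat)
  (A : set (@chart R T d)) :=
  @isSubBaseTopological.Build (glued A) (set T) (glued_subbase A) id.

Definition glued_charted (R : realType) (T : Type) (d : nat)
  (A : set (@chart R T d)) : charted d := @Charted R d (glued A) A.

(* A smooth section of the line bundle pr^* Lambda^n T^*X over M: a value is
   given by its coefficient at dx^1 /\ ... /\ dx^n in every chart of X, and
   these coefficients transform with the Jacobian determinant det(dx/dx'). *)
Record hdensity (R : realType) (n d : nat) (X : @charted R n)
    (M : @charted R d) (pr : M -> X) := HDensity {
  coef : chart X n -> M -> R;
  coef_law : forall a b : chart X n, smooth_chart a -> smooth_chart b ->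
    forall z, dom a (pr z) -> dom b (pr z) ->
    coef b z = \det (jac b a (pr z)) * coef a z;
  coef_smooth : forall a : chart X n, smooth_chart a ->
    forall c : chart M d, atlas c ->
    smooth_on (crd c @` (dom c `&` pr @^-1` dom a)) (inchart c (coef a)) }.

Section Fibred.
Context {R : realType} {n m : nat} {X : @charted R n} {Y : @charted R (n + m)}.
Implicit Type pi : Y -> X.

Definition fibred_manifold pi : Prop :=
  [/\ smooth_map pi, (forall x, exists y, pi y = x) &
      forall y (b : chart Y (n + m)) (a : chart X n),
        smooth_chart b -> smooth_chart a -> dom b y -> dom a (pi y) ->
        row_full ('J (inchart b (fun w => crd a (pi w))) (crd b y))].

(* fibred coordinates (x^l, y^i) *)
Record fchart pi := FChart {
  fY : chart Y (n + m);
  fX : chart X n;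
  fY_smooth : smooth_chart fY;
  fX_smooth : smooth_chart fX;
  fY_over : forall y, dom fY y ->
    dom fX (pi y) /\ lsubmx (crd fY y) = crd fX (pi y) }.

Definition local_section pi (x : X) (s : X -> Y) : Prop :=
  smooth_at s x /\ \forall x' \near x, pi (s x') = x'.

(* entry (l, i) is the derivative of y^i o s with respect to x^l *)
Definition section_deriv pi (c : fchart pi) (s : X -> Y) (x : X) :
    'M[R]_(n, m) :=
  'J (inchart (fX c) (fun x' => rsubmx (crd (fY c) (s x')))) (crd (fX c) x).

Definition jet_equiv pi (x : X) (s s' : X -> Y) : Prop :=
  s x = s' x /\ forall c : fchart pi, dom (fY c) (s x) ->
    section_deriv c s x = section_deriv c s' x.

(* a point of J^1 Y: a point x of X and the class of a local section near x *)
Record jet pi := Jet {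
  jet_src : X;
  jet_class : set (X -> Y);
  jet_ax : exists2 s, local_section pi jet_src s &
    jet_class = [set s' | local_section pi jet_src s' /\
                          jet_equiv pi jet_src s s'] }.

Definition jet_rep pi (z : jet pi) : X -> Y := s2val (cid2 (jet_ax z)).

Definition jet_base pi (z : jet pi) : Y := jet_rep z (jet_src z).

Definition jet_coord pi (c : fchart pi) (z : jet pi) : 'M[R]_(n, m) :=
  section_deriv c (jet_rep z) (jet_src z).

Definition jet_chart pi (c : fchart pi) : chart (jet pi) (n + m + n * m) :=
  Chart [set z | dom (fY c) (jet_base z)]
        (fun z => row_mx (crd (fY c) (jet_base z)) (mxvec (jet_coord c z))).

Definition J1 pi : charted (n + m + n * m) :=
  glued_charted [set a | exists c : fchart pi, a = jet_chart c].

(* A point of Lambda^n T^*X (x) TX (x) V^*Y over y, given by its components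
   p^l_i (row l, column i) in every fibred chart around y, subject to
   p'^l_i = det(dx/dx') (dx'^l/dx^k) (dy^j/dy'^i) p^k_j.
   Off the domain of a chart the components are set to 0, so that equality of
   such records is equality of points. *)
Record momentum pi := Momentum {
  mom_base : Y;
  mom_coord : fchart pi -> 'M[R]_(n, m);
  mom_law : forall c c' : fchart pi,
    dom (fY c) mom_base -> dom (fY c') mom_base ->
    mom_coord c' =
      \det (jac (fX c') (fX c) (pi mom_base)) *:
      ((jac (fX c) (fX c') (pi mom_base))^T *m mom_coord c *m
       (drsubmx (jac (fY c') (fY c) mom_base))^T);
  mom_off : forall c : fchart pi, ~ dom (fY c) mom_base -> mom_coord c = 0 }.

Definition mom_chart pi (c : fchart pi) :
    chart (momentum pi) (n + m + n * m) :=
  Chart [set q | dom (fY c) (mom_base q)]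
        (fun q => row_mx (crd (fY c) (mom_base q)) (mxvec (mom_coord q c))).

Definition Pi pi : charted (n + m + n * m) :=
  glued_charted [set a | exists c : fchart pi, a = mom_chart c].

Definition jet_proj pi : J1 pi -> X := fun z => pi (jet_base z).
Definition mom_proj pi : Pi pi -> X := fun q => pi (mom_base q).

Definition lagrangian pi := hdensity (@jet_proj pi).

(* partial derivatives with respect to the last n * m coordinates of a chart *)
Definition fibre_grad (T : Type) (a : @chart R T (n + m + n * m))
    (f : T -> R) (z : T) : 'M[R]_(n, m) :=
  \matrix_(l, i) 'D_(row_mx 0 (mxvec (delta_mx l i))) (inchart a f) (crd a z).

Definition lag_momentum pi (L : lagrangian pi) (c : fchart pi) (z : J1 pi) :
    'M[R]_(n, m) :=
  fibre_grad (jet_chart c) (coef L (fX c)) z.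

Definition legendre_morphism pi (L : lagrangian pi) (Lhat : J1 pi -> Pi pi) :
    Prop :=
  (forall z, mom_base (Lhat z) = jet_base z) /\
  forall (c : fchart pi) z, dom (jet_chart c) z ->
    mom_coord (Lhat z) c = lag_momentum L c z.

Definition constraint_space pi (Lhat : J1 pi -> Pi pi) : set (Pi pi) :=
  range Lhat.

Definition semiregular pi (Lhat : J1 pi -> Pi pi) : Prop :=
  forall p, constraint_space Lhat p ->
    connected (Lhat @^-1` [set p]) /\ submanifold (Lhat @^-1` [set p]).

Definition connection pi (Gamma : Y -> J1 pi) : Prop :=
  smooth_map Gamma /\ forall y, jet_base (Gamma y) = y.

Definition mom_contract (p v : 'M[R]_(n, m)) : R := \sum_l \sum_i p l i * v l i.

(* The coordinate expression of an n-form at a point of J^1 Y or Pi: row k of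
   the argument holds the components of the k-th tangent vector. *)
Definition lform := 'M[R]_(n, n + m + n * m) -> R.

(* dx^1 /\ ... /\ dx^n *)
Definition vol : lform := fun V => \det (lsubmx (lsubmx V)).

(* dy^i /\ omega_l, that is, dx^1 /\ ... /\ dx^n with dx^l replaced by dy^i *)
Definition dy_omega (i : 'I_m) (l : 'I_n) : lform := fun V =>
  \det (\matrix_(k, j) if j == l then rsubmx (lsubmx V) k i
                       else lsubmx (lsubmx V) k j).

(* p^l_i dy^i /\ omega_l *)
Definition theta (p : 'M[R]_(n, m)) : lform := fun V =>
  \sum_l \sum_i p l i * dy_omega i l V.

(* p^l_i dy^i /\ omega_l - h omega, where ham c is the function h in the fibred
   chart c.  The expression h = p^l_i Gamma^i_l + Ht forces the local forms to
   agree on overlaps, so they define a global n-form on Pi. *)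
Record hamiltonian_form pi := HamiltonianForm {
  ham : fchart pi -> Pi pi -> R;
  ham_ax : exists (Gamma : Y -> J1 pi) (Ht : hdensity (@mom_proj pi)),
    connection Gamma /\
    forall (c : fchart pi) q, dom (mom_chart c) q ->
      ham c q = mom_contract (mom_coord q c) (jet_coord c (Gamma (mom_base q)))
                + coef Ht (fX c) q }.

Definition ham_form pi (H : hamiltonian_form pi) (c : fchart pi) (q : Pi pi) :
    lform := fun V =>
  theta (mom_coord q c) V - ham H c q * vol V.

Definition momentum_morphism pi (H : hamiltonian_form pi)
    (Hhat : Pi pi -> J1 pi) : Prop :=
  (forall q, jet_base (Hhat q) = mom_base q) /\
  forall (c : fchart pi) q, dom (mom_chart c) q ->
    jet_coord c (Hhat q) = fibre_grad (mom_chart c) (ham H c) q.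

(* H_Phi *)
Definition morphism_form pi (Phi : Pi pi -> J1 pi) (c : fchart pi)
    (q : Pi pi) : lform := fun V =>
  theta (mom_coord q c) V
  - mom_contract (mom_coord q c) (jet_coord c (Phi q)) * vol V.

Definition associated pi (L : lagrangian pi) (Lhat : J1 pi -> Pi pi)
    (H : hamiltonian_form pi) : Prop :=
  exists Hhat : Pi pi -> J1 pi,
    [/\ momentum_morphism H Hhat,
        (forall q, constraint_space Lhat q -> Lhat (Hhat q) = q) &
        forall (c : fchart pi) q, dom (mom_chart c) q ->
          ham_form H c q =1
          (fun V => morphism_form Hhat c q V
                    + coef L (fX c) (Hhat q) * vol V)].

Definition poincare_cartan pi (L : lagrangian pi) (c : fchart pi) (z : J1 pi) :
    lform := fun V =>
  theta (lag_momentum L c z) V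
  - mom_contract (lag_momentum L c z) (jet_coord c z) * vol V
  + coef L (fX c) z * vol V.

(* pullback by f : J^1 Y -> Pi over Y, in the coordinates of one fibred chart;
   the rows of V are pushed forward by the Jacobian of f *)
Definition pullback pi (f : J1 pi -> Pi pi)
    (alpha : fchart pi -> Pi pi -> lform) (c : fchart pi) (z : J1 pi) :
    lform := fun V =>
  alpha c (f z)
    (V *m 'J (inchart (jet_chart c) (fun w => crd (mom_chart c) (f w)))
             (crd (jet_chart c) z)).

End Fibred.

(* Main.v *)
(* Along a fibre of the Legendre morphism the momentum [p] is constant and the
   base point is fixed, so tangent vectors of the fibre are vertical and
   [d(p . v - L) = p . dv - (dL/dv) . dv = 0].  Semiregularity (the fibre is a
   connected submanifold) makes the energy [p . v - L] constant on the fibre.  If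
   [H] is associated with [L], then [Hhat q] lies in the fibre over [q] and the
   Hamiltonian at [q] is the energy at [Hhat q], hence the energy at any point of
   the fibre.  This gives both claims, the Legendre morphism being over [Y]. *)

Require Import Defs.
From HB Require Import structures.
From mathcomp Require Import all_boot all_order all_algebra.
From mathcomp Require Import all_classical all_reals all_analysis.
From mathcomp Require Import lra.
Import Order.TTheory GRing.Theory Num.Theory.
Import numFieldNormedType.Exports.

Set Implicit Arguments.
Unset Strict Implicit.
Unset Printing Implicit Defensive.

Local Open Scope classical_set_scope.
Local Open Scope ring_scope.

(** * Differentials *)

Section Differentials.
Context {R : realType}.

(** Differentiability depends on the germ only: the first-order expansion of [f] is also one of [g],
    and differentials are unique. This lets an [inchart] be traded for a formula valid near the
    point. *)
Lemma near_eq_is_diff (V W : normedModType R) (f g df : V -> W) (x : V) :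
  {near x, f =1 g} -> is_diff x f df -> is_diff x g df.
Proof.
move=> fg [fx dfE].
have gE : g \o shift x = cst (g x) + 'd f x +o_ 0 id.
  apply/eqaddoP => _/posnumP[e].
  have e0 : 0 < e%:num by [].
  have /eqaddoP/(_ _ e0) := diff_locally fx; apply: filter_app.
  have : \forall h \near (0 : V), f (h + x) = g (h + x).
    have : \forall y \near x, f y = g y by [].
    by rewrite (near_shift 0) subr0.
  apply: filterS => h /= fgh.
  by rewrite [in X in X -> _]/= !fctE /= fgh (nbhs_singleton fg).
have dE := diff_unique (diff_continuous fx) gE.
apply: DiffDef; last by rewrite dE dfE.
by apply/diff_locallyP; rewrite dE; split => //; exact: diff_continuous.
Qed.

(** Continuity is the issue: in finite dimension [f] is a finite sum of coordinates times fixed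
    vectors. *)
Lemma linear_is_diff (d : nat) (W : normedModType R) (f : 'rV[R]_d -> W) x :
  linear f -> is_diff x f f.
Proof.
move=> fl.
pose fM := GRing.isLinear.Build _ _ _ _ _ fl.
pose fL : {linear _ -> _} := HB.pack f fM.
have fc : continuous fL.
  have -> : (fL : _ -> _) = \sum_j (fun v => v 0 j *: fL (delta_mx 0 j)).
    apply/funext => v; rewrite fct_sumE {1}(row_sum_delta v) linear_sum.
    by apply: eq_bigr => j _; rewrite linearZ.
  move=> v; elim/big_ind: _ => [||j _]; first exact: cst_continuous.
    by move=> g h gc hc; apply: continuousD.
  apply: (@continuousZr_tmp _ _ _ (fun w : 'rV[R]_d => w 0 j)).
  exact: coord_continuous.
apply: DiffDef; first exact: (@linear_differentiable _ _ _ fL).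
exact: (@diff_lin _ _ _ fL).
Qed.

Lemma differentiable_rV (V : normedModType R) (d : nat) (f : V -> 'rV[R]_d) x :
  (forall j, differentiable (fun v => f v 0 j) x) -> differentiable f x.
Proof.
move=> fx; have -> : f = \sum_j (fun v => f v 0 j *: delta_mx 0 j).
  by apply/funext => v; rewrite fct_sumE -row_sum_delta.
by apply: differentiable_sum => j; apply: differentiableZl.
Qed.

(** Mean value theorem for the restriction of [G] to the segment; [G] may vary in directions other
    than [v]. *)
Lemma diff_segment_const (V : normedModType R) (G : V -> R) (u v : V) :
  (forall t : R, 0 <= t <= 1 ->
     differentiable G (t *: v + u) /\ 'd G (t *: v + u) v = 0) ->
  G (v + u) = G u.
Proof.
move=> Gt.
have hd (t : R) : 0 <= t <= 1 -> is_derive t 1 (fun s : R => G (s *: v + u)) 0.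
  move=> /Gt[dG G0].
  have dl : is_diff t (fun s : R => s *: v + u) ( *:%R^~ v).
    have := is_diffD (is_diff_scalel t v) (is_diff_cst u t).
    by move/is_diff_eq; apply; apply/funext => s; rewrite !fctE /= addr0.
  have dc : is_diff t (G \o (fun s : R => s *: v + u))
      ('d G (t *: v + u) \o *:%R^~ v).
    exact: (is_diff_comp dl (differentiableP dG)).
  apply: DeriveDef; first by apply: diff_derivable; exact: ex_diff.
  rewrite deriveE; last exact: (@ex_diff _ _ _ _ _ _ _ dc).
  by rewrite (@diff_val _ _ _ _ _ _ _ dc) /= scale1r.
have [||c _] := @MVT_segment R (fun s : R => G (s *: v + u)) (fun=> 0) 0 1 ler01.
- by move=> t; rewrite in_itv/= => /andP[t0 t1]; apply: hd; rewrite !ltW.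
- apply: derivable_within_continuous => t; rewrite in_itv/= => t01.
  by have [] := hd _ t01.
by rewrite mul0r scale1r scale0r add0r => /eqP; rewrite subr_eq0 => /eqP.
Qed.

(** The left inverse bounds [y - x] by a multiple of ['d f x (y - x)], which is of smaller order
    when [f y = f x]. *)
Lemma diff_injective_near (d e : nat) (f : 'rV[R]_d -> 'rV[R]_e)
    (g : {linear 'rV[R]_e -> 'rV[R]_d}) (x : 'rV[R]_d) :
  differentiable f x -> cancel ('d f x) g ->
  \forall y \near x, f y = f x -> y = x.
Proof.
move=> fx fK.
have gc : continuous g.
  move=> v; apply: differentiable_continuous.
  exact: (@ex_diff _ _ _ _ _ _ _ (linear_is_diff v (linearP g))).
have [k k0 gk] := linear_lipschitz gc.
(* As [k] is a Lipschitz constant of [g], this rate bounds the norm of [y - x] by half of itself. *)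
have k2 : 0 < k^-1 / 2 by rewrite divr_gt0// invr_gt0.
have : \forall h \near (0 : 'rV[R]_d),
    `|f (h + x) - (f x + 'd f x h)| <= k^-1 / 2 * `|h|.
  by have /eqaddoP/(_ _ k2) := diff_locally fx.
rewrite (near_shift x 0) sub0r => H.
near=> y => fy.
have : `|f (y - x + x) - (f x + 'd f x (y - x))| <= k^-1 / 2 * `|y - x|.
  by near: y; exact: H.
rewrite subrK fy opprD addNKr normrN => le1.
have le2 : `|y - x| <= k * `|'d f x (y - x)| by rewrite -{1}[y - x]fK gk.
apply/eqP; rewrite -subr_eq0 -normr_le0.
have := le_trans le2 (ler_wpM2l (ltW k0) le1).
by rewrite !mulrA mulfV ?gt_eqF// mul1r; lra.
Unshelve. all: by end_near. Qed.

Lemma diff_line_const (V W : normedModType R) (f : V -> W) (u v : V) :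
  differentiable f u -> (\forall h \near (0 : R), f (h *: v + u) = f u) ->
  'd f u v = 0.
Proof.
move=> df fc; have dl : is_diff (0 : R) (fun s : R => s *: v + u) ( *:%R^~ v).
  have := is_diffD (is_diff_scalel 0 v) (is_diff_cst u (0 : R)).
  by move/is_diff_eq; apply; apply/funext => s; rewrite !fctE /= addr0.
have df0 : differentiable f (0 *: v + u) by rewrite scale0r add0r.
have [_ dE] := is_diff_comp dl (differentiableP df0).
have cE : {near (0 : R), cst (f u) =1 f \o (fun s : R => s *: v + u)}.
  by apply: filterS fc => h /= ->.
have [_ d0] := near_eq_is_diff cE (is_diff_cst (f u) (0 : R)).
have := congr1 (@^~ 1) dE; rewrite /= d0 scale1r.
by rewrite [in X in _ = X -> _]scale0r add0r => <-.
Qed.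

Lemma linear_cancelC (d : nat) (f g : {linear 'rV[R]_d -> 'rV[R]_d}) :
  cancel f g -> cancel g f.
Proof.
move=> fK v; have fg1 : lin1_mx f *m lin1_mx g = 1%:M.
  apply/row_matrixP => i; rewrite !rowE mulmxA !mul_rV_lin1 mulmx1; exact: fK.
by rewrite -2!mul_rV_lin1 -mulmxA (mulmx1C fg1) mulmx1.
Qed.

End Differentials.

(** * Charts and manifolds *)

Section Charts.
Context {R : realType}.

Lemma inchartE (T : Type) (d : nat) (V : zmodType) (a : @chart R T d)
    (f : T -> V) (z : T) :
  {in dom a &, injective (crd a)} -> dom a z -> inchart a f (crd a z) = f z.
Proof.
move=> ai az; apply: xget_unique; first by exists z.
by move=> v [w aw [/ai e <-]]; rewrite e ?inE.
Qed.

Lemma smooth_on_differentiable (E F : normedModType R) (U : set E)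
    (f : E -> F) (x : E) : smooth_on U f -> U x -> differentiable f x.
Proof. by move=> /(_ 1%N)[+ _]; exact. Qed.

Lemma smooth_on_differentiable_diff (E F : normedModType R) (U : set E)
    (f : E -> F) (x v : E) :
  smooth_on U f -> U x -> differentiable (fun y => 'd f y v) x.
Proof. by move=> /(_ 2%N)[_ /(_ v)[+ _]]; exact. Qed.

Lemma chart_nbhs (T : topologicalType) (d : nat) (a : @chart R T d)
    (z : T) (U : set T) :
  is_chart a -> dom a z -> nbhs z U ->
  nbhs (crd a z) (crd a @` (dom a `&` U)).
Proof.
move=> [oa _ _ ao] az; rewrite nbhsE => -[B [oB Bz] BU].
have : nbhs (crd a z) (crd a @` (dom a `&` B)).
  apply: open_nbhs_nbhs; split; last by exists z.
  by apply: ao; [exact: openI|exact: subIsetl].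
by apply: filterS; apply: image_subset; exact: setIS.
Qed.

Lemma chart_continuous (T : topologicalType) (d : nat) (a : @chart R T d)
    (z : T) (V : set 'rV[R]_d) :
  is_chart a -> dom a z -> nbhs (crd a z) V -> nbhs z (crd a @^-1` V).
Proof.
move=> [_ _ ca _] az zV; have : nbhs z (dom a `&` crd a @^-1` V°).
  by apply: open_nbhs_nbhs; split => //; apply: ca; exact: open_interior.
by apply: filterS => w [_ /interior_subset].
Qed.

Lemma inchart_near (T : topologicalType) (d : nat) (V : normedModType R)
    (a : @chart R T d) (f : T -> V) (G : 'rV[R]_d -> V) (z : T) :
  is_chart a -> dom a z -> (\forall w \near z, dom a w -> G (crd a w) = f w) ->
  {near crd a z, G =1 inchart a f}.
Proof.
move=> ca az /(chart_nbhs ca az); apply: filterS => _ [w [aw Gw] <-] /=.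
by case: ca => _ ai _ _; rewrite inchartE ?Gw.
Qed.

Lemma chart_dom_near (T : topologicalType) (d : nat) (a : @chart R T d) (z : T) :
  is_chart a -> dom a z -> \forall w \near z, dom a w.
Proof. by move=> [oa _ _ _] az; apply: open_nbhs_nbhs. Qed.

(** Chain rule read in charts. Of [b] only injectivity is asked, so that a jet chart can take its
    place. *)
Lemma inchart_comp_is_diff (T : topologicalType) (S : Type) (d e : nat)
    (V : normedModType R) (a : @chart R T d) (b : @chart R S e)
    (h : T -> S) (g : S -> V) (z : T) :
  is_chart a -> dom a z -> {in dom b &, injective (crd b)} ->
  (\forall w \near z, dom b (h w)) ->
  differentiable (inchart a (crd b \o h)) (crd a z) ->
  differentiable (inchart b g) (crd b (h z)) ->
  is_diff (crd a z) (inchart a (g \o h))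
    ('d (inchart b g) (crd b (h z)) \o 'd (inchart a (crd b \o h)) (crd a z)).
Proof.
move=> ca az bi bh da db; have [_ ai _ _] := ca.
have hz : inchart a (crd b \o h) (crd a z) = crd b (h z) by rewrite inchartE.
rewrite -hz in db *.
apply: near_eq_is_diff (is_diff_comp (differentiableP da) (differentiableP db)).
apply: inchart_near => //; apply: filterS bh => w bhw aw /=.
by rewrite !inchartE.
Qed.

Lemma inchart_change_is_diff (T : topologicalType) (d e : nat)
    (V : normedModType R) (a : @chart R T d) (b : @chart R T e) (g : T -> V)
    (z : T) :
  is_chart a -> dom a z -> {in dom b &, injective (crd b)} ->
  (\forall w \near z, dom b w) ->
  differentiable (inchart a (crd b)) (crd a z) ->
  differentiable (inchart b g) (crd b z) ->
  is_diff (crd a z) (inchart a g)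
    ('d (inchart b g) (crd b z) \o 'd (inchart a (crd b)) (crd a z)).
Proof. exact: (@inchart_comp_is_diff _ _ _ _ _ a b id g z). Qed.

Lemma inchart_linear_is_diff (T : topologicalType) (d e : nat)
    (V : normedModType R) (a : @chart R T d) (h : T -> 'rV[R]_e)
    (g : 'rV[R]_e -> V) (z : T) :
  is_chart a -> dom a z -> linear g -> differentiable (inchart a h) (crd a z) ->
  is_diff (crd a z) (inchart a (g \o h)) (g \o 'd (inchart a h) (crd a z)).
Proof.
move=> ca az lg da; have [_ ai _ _] := ca.
apply: near_eq_is_diff (is_diff_comp (differentiableP da)
  (linear_is_diff _ lg)).
by apply: inchart_near => //; apply: filterE => w aw /=; rewrite inchartE.
Qed.

Lemma compatible_differentiable (T : topologicalType) (d : nat)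
    (a b : @chart R T d) (z : T) :
  compatible a b -> dom a z -> dom b z ->
  differentiable (inchart a (crd b)) (crd a z) /\
  differentiable (inchart b (crd a)) (crd b z).
Proof.
move=> [ab ba] az bz; split.
  by apply: smooth_on_differentiable ab _; exists z.
by apply: smooth_on_differentiable ba _; exists z.
Qed.

(** By definition a smooth chart is compatible with the charts of the atlas, so the change of charts
    goes through an atlas chart around [z]. *)
Lemma chart_change_differentiable (d : nat) (M : @charted R d)
    (a b : chart M d) (z : M) :
  manifold M -> smooth_chart a -> smooth_chart b -> dom a z -> dom b z ->
  differentiable (inchart a (crd b)) (crd a z).
Proof.
move=> [Ms Mc _ _ _] [ca sa] [cb sb] az bz.
have [e Ae ez] := Mc z; have [ce _] := Ms _ Ae.
have [ae _] := compatible_differentiable (sa _ Ae) az ez.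
have [_ eb] := compatible_differentiable (sb _ Ae) bz ez.
have [_ ei _ _] := ce.
by have [] := inchart_change_is_diff ca az ei (chart_dom_near ce ez) ae eb.
Qed.

(** [smooth_at] provides one pair of charts; the chain rule passes from it to the given pair. *)
Lemma smooth_at_differentiable (d e : nat) (M : @charted R d) (N : @charted R e)
    (s : M -> N) (z : M) (a : chart M d) (b : chart N e) :
  manifold M -> manifold N -> smooth_at s z ->
  smooth_chart a -> smooth_chart b -> dom a z -> dom b (s z) ->
  (\forall w \near z, dom b (s w)) /\
  differentiable (inchart a (crd b \o s)) (crd a z).
Proof.
move=> mM mN [a' [b' [sa' sb' a'z a'b' smooth]]] sa sb az bz.
have [ca _] := sa; have [cb _] := sb; have [ca' _] := sa'; have [cb' _] := sb'.
have [_ a'i _ _] := ca'; have [_ b'i _ _] := cb'.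
have ds : differentiable (inchart a' (crd b' \o s)) (crd a' z).
  by apply: smooth_on_differentiable smooth _; exists z.
have b'z : dom b' (s z) by exact: a'b'.
have nb : \forall w \near z, dom b (s w).
  (* Continuity of [s] at [z] is drawn from that of its coordinate expression. *)
  have nv := chart_nbhs cb' b'z (chart_dom_near cb bz).
  have sz : inchart a' (crd b' \o s) (crd a' z) = crd b' (s z).
    by rewrite inchartE.
  rewrite -sz in nv.
  have /(chart_continuous ca' a'z) := differentiable_continuous ds nv.
  apply: filterS2 (chart_dom_near ca' a'z) => w a'w /=.
  rewrite inchartE // => -[y [b'y by_] /b'i ysw].
  by rewrite -ysw ?inE //; exact: a'b'.
split=> //.
have nb' : \forall w \near z, dom b' (s w).
  by apply: filterS (chart_dom_near ca' a'z) => w; exact: a'b'.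
have d1 : differentiable (inchart a' (crd b \o s)) (crd a' z).
  have db := chart_change_differentiable mN sb' sb b'z bz.
  by have [] := inchart_comp_is_diff ca' a'z b'i nb' ds db.
have da := chart_change_differentiable mM sa sa' az a'z.
by have [] := inchart_change_is_diff ca az a'i (chart_dom_near ca' a'z) da d1.
Qed.

(* [inchart b (crd a)] vanishes off the image of [b], while its differential
   there is invertible: this replaces the inverse function theorem. *)
Lemma compatible_image_nbhs (T : topologicalType) (d : nat)
    (a b : @chart R T d) (z : T) :
  is_chart a -> {in dom b &, injective (crd b)} -> compatible a b ->
  dom a z -> (\forall w \near z, dom b w) ->
  nbhs (crd b z) (crd b @` dom b).
Proof.
move=> ca bi ab az nbz; have bz := nbhs_singleton nbz.
have [dab dba] := compatible_differentiable ab az bz.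
have [_ ai _ _] := ca.
set phi := inchart a (crd b) in dab; set psi := inchart b (crd a) in dba.
have [_ dE] := inchart_change_is_diff ca az bi nbz dab dba.
have id_near : {near crd a z, id =1 inchart a (crd a)}.
  by apply: inchart_near => //; exact: filterE.
have [_ did] := near_eq_is_diff id_near (is_diff_id _).
have psiK : cancel ('d psi (crd b z)) ('d phi (crd a z)).
  apply: linear_cancelC => v; exact (congr1 (@^~ v) (etrans (esym dE) did)).
have psi0 y : psi y <> 0 -> (crd b @` dom b) y.
  move=> py; apply: contrapT => ny; apply: py; apply: xgetPN => v [w bw [wy _]].
  by apply: ny; exists w.
(* If [psi] vanishes at [crd b z], nearby points off the image share this value, so local
   injectivity makes them equal to [crd b z], which is in the image. Otherwise [psi] stays nonzero
   nearby. *)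
have [p0|p0] := pselect (psi (crd b z) = 0).
  apply: filterS (diff_injective_near dba psiK) => y yz.
  have [py|/psi0//] := pselect (psi y = 0).
  by rewrite yz ?p0 //; exists z.
have pn0 : psi (crd b z) != 0 by apply/eqP.
have : \forall y \near crd b z, psi y != 0.
  exact: (@cvgr_neq0 _ _ _ (nbhs (crd b z)) _ psi _
    (differentiable_continuous dba) pn0).
by apply: filterS => y /eqP/psi0.
Qed.

End Charts.

(** * Jets of sections *)

Section Jets.
Context {R : realType} {n m : nat} {X : @charted R n} {Y : @charted R (n + m)}.
Variable pi : Y -> X.
Hypotheses (manX : manifold X) (manY : manifold Y).

Lemma local_section_base (x : X) (s : X -> Y) :
  local_section pi x s -> pi (s x) = x.
Proof. by move=> [_ /nbhs_singleton]. Qed.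

Lemma fchart_section (c : fchart pi) (x : X) (s : X -> Y) :
  local_section pi x s -> dom (fY c) (s x) ->
  [/\ dom (fX c) x, \forall x' \near x, dom (fY c) (s x') &
      differentiable (inchart (fX c) (crd (fY c) \o s)) (crd (fX c) x)].
Proof.
move=> ls cs; have [cx _] := fY_over cs; rewrite (local_section_base ls) in cx.
have [smooth _] := ls.
by have [] := smooth_at_differentiable manX manY smooth (fX_smooth c)
  (fY_smooth c) cx cs.
Qed.

(** The chart is fibred and [s] is a section, so the first [n] coordinates of [s] read as the
    identity near [x]. *)
Lemma diff_section (c : fchart pi) (x : X) (s : X -> Y) (v : 'rV[R]_n) :
  local_section pi x s -> dom (fY c) (s x) ->
  'd (inchart (fX c) (crd (fY c) \o s)) (crd (fX c) x) v =
  row_mx v (v *m section_deriv c s x).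
Proof.
move=> ls cs; have [cx ncs ds] := fchart_section ls cs.
have [cX _] := fX_smooth c.
rewrite -[LHS]hsubmxK; congr row_mx.
  have [_ dE] := inchart_linear_is_diff cX cx (linearP lsubmx) ds.
  rewrite -[LHS]/((lsubmx \o _) v) -dE.
  have id_near : {near crd (fX c) x,
      id =1 inchart (fX c) (lsubmx \o (crd (fY c) \o s))}.
    apply: inchart_near => //; have [_ sec] := ls.
    near=> w => cw /=; have [|_ ->] := @fY_over _ _ _ _ _ _ c (s w).
      by near: w.
    by congr crd; near: w; apply: filterS sec.
  by have [_ ->] := near_eq_is_diff id_near (is_diff_id _).
have [_ dE] := inchart_linear_is_diff cX cx (linearP rsubmx) ds.
by rewrite /section_deriv /jacobian mul_rV_lin1 /= -[LHS]/((rsubmx \o _) v) -dE.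
Unshelve. all: by end_near. Qed.

(** One fibred chart is enough to test jet equivalence, by the chain rule for the changes of charts
    on [X] and [Y]. *)
Lemma jet_equiv_fchart (c : fchart pi) (x : X) (s s' : X -> Y) :
  local_section pi x s -> local_section pi x s' -> s x = s' x ->
  dom (fY c) (s x) -> section_deriv c s x = section_deriv c s' x ->
  jet_equiv pi x s s'.
Proof.
move=> ls ls' ss' cs dss'; split; [exact: ss'|move=> c' c's].
(* The right-hand side depends on [t] only through [section_deriv c t x]. *)
suff dE (t : X -> Y) : local_section pi x t -> t x = s x -> forall v,
    row_mx v (v *m section_deriv c' t x) =
    'd (inchart (fY c) (crd (fY c'))) (crd (fY c) (s x))
      (let w := 'd (inchart (fX c') (crd (fX c))) (crd (fX c') x) v in
       row_mx w (w *m section_deriv c t x)).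
  have mulmx_inj (A A' : 'M[R]_(n, m)) :
      (forall v : 'rV_n, v *m A = v *m A') -> A = A'.
    by move=> AA'; apply/row_matrixP => i; rewrite !rowE.
  apply: mulmx_inj => v; have e := dE _ ls erefl v; rewrite dss' in e.
  by case/eq_row_mx: (etrans e (esym (dE _ ls' (esym ss') v))).
move=> lt ts v; have ct : dom (fY c) (t x) by rewrite ts.
have c't : dom (fY c') (t x) by rewrite ts.
have [cx nct dt] := fchart_section lt ct.
have [c'x nc't _] := fchart_section lt c't.
have [cX _] := fX_smooth c; have [c'X _] := fX_smooth c'.
have [[_ ciY _ _] _] := fY_smooth c; have [_ ciX _ _] := cX.
have dX := chart_change_differentiable manX (fX_smooth c') (fX_smooth c) c'x cx.
have dY := chart_change_differentiable manY (fY_smooth c) (fY_smooth c') ct c't.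
have [dt' dt'E] := inchart_change_is_diff c'X c'x ciX (chart_dom_near cX cx)
  dX dt.
have [_ dc'E] := inchart_comp_is_diff c'X c'x ciY nct dt' dY.
rewrite -ts; apply: etrans (esym (diff_section v lt c't)) _.
apply: etrans (congr1 (@^~ v) dc'E) _; apply: (congr1 ('d _ _)).
apply: etrans (congr1 (@^~ v) dt'E) _.
exact: (diff_section ('d (inchart (fX c') (crd (fX c))) (crd (fX c') x) v) lt ct).
Qed.

Lemma jet_rep_section (z : jet pi) :
  local_section pi (jet_src z) (jet_rep z).
Proof. exact: s2valP (cid2 (jet_ax z)). Qed.

Lemma jet_src_base (z : jet pi) : jet_src z = pi (jet_base z).
Proof. by rewrite (local_section_base (jet_rep_section z)). Qed.

(** The class stored in a jet is that of its representative, so equivalent representatives give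
    equal classes; the proof fields agree by proof irrelevance. *)
Lemma jet_eq (z z' : jet pi) :
  jet_src z = jet_src z' -> jet_equiv pi (jet_src z) (jet_rep z) (jet_rep z') ->
  z = z'.
Proof.
have := s2valP' (cid2 (jet_ax z)); have := s2valP' (cid2 (jet_ax z')).
rewrite -/(jet_rep z) -/(jet_rep z').
(* [jet_rep] depends on the proof field, hence this generalization before the records are taken
   apart. *)
move: (jet_rep z) (jet_rep z') => s s'.
case: z z' => [x C C_ax] [x' C' C'_ax] /= C'E CE xx'.
subst x' => -[ss' dss'].
have CC' : C = C'.
  rewrite CE C'E; apply/seteqP; split=> t [lt [st dst]].
  - split; [exact: lt|split; first exact: etrans (esym ss') st].
    move=> c cs; rewrite -ss' in cs.
    exact (etrans (esym (dss' c cs)) (dst c cs)).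
  - split; [exact: lt|split; first exact: etrans ss' st].
    move=> c cs; have c's := cs; rewrite ss' in c's.
    exact (etrans (dss' c cs) (dst c c's)).
clear CE C'E; subst C'; rewrite (Prop_irrelevance C_ax C'_ax); reflexivity.
Qed.

(** The base coordinates recover the base point, hence the source; the remaining ones give equal
    derivatives in [c], which settles jet equivalence. *)
Lemma jet_chart_inj (c : fchart pi) :
  {in dom (jet_chart c) &, injective (crd (jet_chart c))}.
Proof.
move=> z z'; rewrite !inE /= => cz cz' /eq_row_mx[zz' dzz'].
have [[_ ci _ _] _] := fY_smooth c.
have base : jet_base z = jet_base z' by apply: ci; rewrite ?inE.
have src : jet_src z = jet_src z' by rewrite !jet_src_base base.
apply: (jet_eq src); apply: (jet_equiv_fchart (c := c)).
- exact: jet_rep_section.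
- by rewrite src; exact: jet_rep_section.
- by rewrite {2}src; exact: base.
- exact: cz.
- by rewrite {2}src; apply: (can_inj mxvecK); exact: dzz'.
Qed.

Lemma jet_chart_open (c : fchart pi) : open (dom (jet_chart c) : set (J1 pi)).
Proof.
exists [set dom (jet_chart c)]; last by rewrite bigcup_set1.
move=> _ ->; apply: finI_from1; exists (jet_chart c); first by exists c.
by exists setT; [exact: openT|rewrite preimage_setT setIT].
Qed.

End Jets.

(** * The energy along the fibres of the Legendre morphism *)

(** The level set of [g] through [z] is relatively open and relatively closed in [S]. *)
Lemma connected_locally_const (T : topologicalType) (V : Type) (S : set T)
    (g : T -> V) (z w : T) :
  connected S -> (forall x, S x -> \forall y \near x, S y -> g y = g x) ->
  S z -> S w -> g w = g z.
Proof.
move=> cS gS Sz Sw; have [] // : (S `&` [set y | g y = g z]) w.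
rewrite (cS (S `&` [set y | g y = g z])) //; first by exists z.
- exists [set y | S y -> g y = g z]°; first exact: open_interior.
  apply/seteqP; split=> y [Sy gy]; split=> //.
    by apply: filterS (gS _ Sy) => x gx /gx ->.
  by apply: (interior_subset gy).
- exists (~` [set y | S y -> g y <> g z]°).
    exact/open_closedC/open_interior.
  apply/seteqP; split=> y [Sy gy]; split=> //.
    by move=> /interior_subset/(_ Sy).
  apply: contrapT => gyz; apply: gy.
  by apply: filterS (gS _ Sy) => x gx /gx ->.
Qed.

Section Legendre.
Context {R : realType} {n m : nat} {X : @charted R n} {Y : @charted R (n + m)}.
Variable pi : Y -> X.
Hypotheses (manX : manifold X) (manY : manifold Y).
Variable L : lagrangian pi.

Lemma lagrangian_smooth (c : fchart pi) :
  smooth_on (crd (jet_chart c) @` dom (jet_chart c))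
    (inchart (jet_chart c) (coef L (fX c))).
Proof.
have := @coef_smooth _ _ _ _ _ _ L (fX c) (fX_smooth c) (jet_chart c).
have -> : dom (jet_chart c) `&` @jet_proj _ _ _ _ _ pi @^-1` dom (fX c) =
    dom (jet_chart c).
  by apply/setIidPl => z cz; have [] := fY_over cz.
by apply; exists c.
Qed.

(** Expands a vertical tangent vector along the directions used by [fibre_grad]. *)
Lemma mxvec_sum_delta (W : 'M[R]_(n, m)) :
  row_mx 0 (mxvec W) = \sum_l \sum_i W l i *: row_mx 0 (mxvec (delta_mx l i))
  :> 'rV[R]_(n + m + n * m).
Proof.
rewrite -[RHS]hsubmxK; congr row_mx.
  rewrite linear_sum big1 // => l _; rewrite linear_sum big1 // => i _.
  by rewrite linearZ /= row_mxKl scaler0.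
rewrite {1}(matrix_sum_delta W) !linear_sum; apply: eq_bigr => l _.
rewrite !linear_sum; apply: eq_bigr => i _.
by rewrite !linearZ /= row_mxKr.
Qed.

Lemma diff_lagrangian_vertical (c : fchart pi) (z : J1 pi) (W : 'M[R]_(n, m)) :
  dom (jet_chart c) z ->
  'd (inchart (jet_chart c) (coef L (fX c))) (crd (jet_chart c) z)
    (row_mx 0 (mxvec W)) = mom_contract (lag_momentum L c z) W.
Proof.
move=> cz.
have dF : differentiable (inchart (jet_chart c) (coef L (fX c)))
    (crd (jet_chart c) z).
  by apply: smooth_on_differentiable (lagrangian_smooth c) _; exists z.
rewrite mxvec_sum_delta linear_sum; apply: eq_bigr => l _.
rewrite linear_sum; apply: eq_bigr => i _.
by rewrite linearZ /lag_momentum /fibre_grad mxE deriveE // mulrC.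
Qed.

Lemma row_lsubmx (p n1 n2 : nat) (A : 'M[R]_(p, n1 + n2)) (i : 'I_p) :
  row i (lsubmx A) = lsubmx (row i A).
Proof. by apply/rowP => j; rewrite !mxE. Qed.

Lemma linear_mom_contract (p : 'M[R]_(n, m)) :
  linear (fun x : 'rV[R]_(n + m + n * m) => mom_contract p (vec_mx (rsubmx x))).
Proof.
move=> k x y; rewrite /mom_contract scaler_sumr -big_split; apply: eq_bigr => l _.
rewrite scaler_sumr -big_split; apply: eq_bigr => i _.
by rewrite !linearP !mxE mulrDr /= [k *: _]mulrCA.
Qed.

Variable Lhat : J1 pi -> Pi pi.
Hypothesis legL : legendre_morphism L Lhat.

(** The momentum [p] is a separate argument, so that it can be frozen along a fibre of [Lhat], where
    it is constant. *)
Definition lag_energy (p : 'M[R]_(n, m)) (c : fchart pi) (z : J1 pi) : R :=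
  mom_contract p (jet_coord c z) - coef L (fX c) z.

Lemma fibre_jet_base (q : Pi pi) (z : J1 pi) :
  Lhat z = q -> jet_base z = mom_base q.
Proof. by move=> <-; case: legL => ->. Qed.

(** * Local constancy of the energy, in a slice chart of one fibre *)

Section Fibre.
Variables (c : fchart pi) (q : Pi pi).
Hypothesis cq : dom (mom_chart c) q.
Let S := Lhat @^-1` [set q].
Let jc : @chart R (J1 pi) (n + m + n * m) := jet_chart c.
Variables (k : nat) (a : @chart R (J1 pi) (n + m + n * m)).
Hypotheses (sa : smooth_chart a)
  (slice : forall w, dom a w ->
    (S w <-> forall j : 'I_(n + m + n * m), (k <= j)%N -> crd a w 0 j = 0)).

(** [E] is the energy in jet coordinates with the momentum of [q]; [G] is [E] read in the slice
    chart [a], where the fibre is a coordinate subspace. *)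
Let E x := mom_contract (mom_coord q c) (vec_mx (rsubmx x))
             - inchart jc (coef L (fX c)) x.
Let G := E \o inchart a (crd jc).

Let fibre_dom (w : J1 pi) : S w -> dom jc w.
Proof. by move=> /fibre_jet_base Sw; rewrite /jc /= Sw. Qed.

Let jc_inj : {in dom jc &, injective (crd jc)}.
Proof. exact: jet_chart_inj manX manY c. Qed.

Let a_inj : {in dom a &, injective (crd a)}.
Proof. by case: sa => -[]. Qed.

Let jc_near (w : J1 pi) : dom jc w -> \forall y \near w, dom jc y.
Proof. by move=> jw; apply: open_nbhs_nbhs; split; [exact: jet_chart_open|]. Qed.

Let a_jc (w : J1 pi) : dom a w -> dom jc w ->
  differentiable (inchart a (crd jc)) (crd a w).
Proof.
move=> aw jw; have [_ /(_ jc) ajc] := sa.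
by have [] := compatible_differentiable (ajc (ex_intro _ c erefl)) aw jw.
Qed.

Let G_energy (w : J1 pi) : dom a w -> dom jc w ->
  G (crd a w) = lag_energy (mom_coord q c) c w.
Proof.
move=> aw jw; rewrite /G /E /= (inchartE (crd jc) a_inj aw).
by rewrite (inchartE (coef L (fX c)) jc_inj jw) /= row_mxKr mxvecK.
Qed.

(** A short line in a slice direction stays in the fibre, all of whose points have base point
    [mom_base q], so its base coordinates are constant. *)
Let diff_slice_vertical (w : J1 pi) (v : 'rV[R]_(n + m + n * m)) :
  dom a w -> S w -> (forall j : 'I__, (k <= j)%N -> v 0 j = 0) ->
  lsubmx ('d (inchart a (crd jc)) (crd a w) v) = 0.
Proof.
move=> aw Sw v0; have jw := fibre_dom Sw; have da := a_jc aw jw.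
have [ca _] := sa.
have [dl dlE] := inchart_linear_is_diff ca aw (linearP lsubmx) da.
rewrite -[LHS]/((lsubmx \o _) v) -dlE; apply: diff_line_const => //.
have nw := chart_nbhs ca aw (chart_dom_near ca aw).
have line0 : (fun h : R => h *: v + crd a w) @ (0 : R) --> crd a w.
  rewrite -[X in _ --> X]add0r -(scale0r v).
  apply: cvgD; last exact: cvg_cst.
  exact: (@scalel_continuous _ _ v 0).
have near_img : \forall h \near (0 : R),
    (crd a @` (dom a `&` dom a)) (h *: v + crd a w) := line0 _ nw.
have base_val y : dom a y -> S y ->
    inchart a (lsubmx \o crd jc) (crd a y) = crd (fY c) (mom_base q).
  move=> ay Sy; rewrite (inchartE _ a_inj ay).
  by rewrite -(fibre_jet_base Sy); exact: row_mxKl.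
apply: filterS near_img => h [w' [aw' _] w'E].
have Sw' : S w'.
  apply/(slice aw') => j kj; rewrite w'E !mxE v0 // (slice aw).1 //.
  by rewrite mulr0 addr0.
by rewrite -w'E (base_val _ aw' Sw') (base_val _ aw Sw).
Qed.

(** A slice direction is sent to a vertical vector, on which the differential of the Lagrangian is
    contraction with the momentum at [w]. That momentum is the one of [q], so the two terms of [E]
    cancel. *)
Let diff_G_slice (w : J1 pi) (v : 'rV[R]_(n + m + n * m)) :
  dom a w -> S w -> (forall j : 'I__, (k <= j)%N -> v 0 j = 0) ->
  differentiable G (crd a w) /\ 'd G (crd a w) v = 0.
Proof.
move=> aw Sw v0; have jw := fibre_dom Sw; have da := a_jc aw jw.
have phiw : inchart a (crd jc) (crd a w) = crd jc w by rewrite inchartE.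
have dF : differentiable (inchart jc (coef L (fX c))) (crd jc w).
  by apply: smooth_on_differentiable (lagrangian_smooth c) _; exists w.
have dE := is_diffB (linear_is_diff (crd jc w) (linear_mom_contract (mom_coord q c)))
  (differentiableP dF).
rewrite -phiw in dE.
have [dG dGE] := is_diff_comp (differentiableP da) dE.
split; first exact: dG.
rewrite -[LHS]/('d G (crd a w) v) dGE /= phiw.
set v' := 'd _ _ v.
have v'E : v' = row_mx 0 (mxvec (vec_mx (rsubmx v'))).
  by rewrite vec_mxK -[LHS]hsubmxK diff_slice_vertical.
rewrite !fctE /= {2}v'E diff_lagrangian_vertical // -(legL.2 _ _ jw).
by rewrite (Sw : Lhat w = q) subrr.
Qed.

Lemma energy_slice_const (z : J1 pi) :
  dom a z -> S z -> \forall w \near z, S w ->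
  lag_energy (mom_coord q c) c w = lag_energy (mom_coord q c) c z.
Proof.
move=> az Sz; have [ca _] := sa.
(* A ball inside the image of the common domain contains the segment from [crd a z] to each of its
   points; the slice equations are linear, so the segment also stays in the fibre. *)
have /nbhs_ballP[e e0 ball_img] := chart_nbhs ca az (jc_near (fibre_dom Sz)).
have nball := chart_continuous ca az (nbhsx_ballx (crd a z) e e0).
apply: filterS2 (chart_dom_near ca az) nball => w aw /= wz Sw.
rewrite -!G_energy //; try exact: fibre_dom.
have v0 (j : 'I__) : (k <= j)%N -> (crd a w - crd a z) 0 j = 0.
  by move=> kj; rewrite !mxE (slice aw).1 // (slice az).1 // subrr.
rewrite -{1}[crd a w](subrK (crd a z)); apply: diff_segment_const => t /andP[t0 t1].
have [y [ay jy] yE] : (crd a @` (dom a `&` dom jc))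
    (t *: (crd a w - crd a z) + crd a z).
  apply: ball_img; move: wz; rewrite -ball_normE /= => wz.
  rewrite opprD addrCA subrr addr0 normrN normrZ ger0_norm //.
  by rewrite distrC (le_lt_trans _ wz) // ler_piMl.
have Sy : S y.
  apply/(slice ay) => j kj; have := v0 _ kj.
  by rewrite yE !mxE => ->; rewrite mulr0 add0r (slice az).1.
by rewrite -yE; exact: diff_G_slice.
Qed.

End Fibre.

Lemma energy_fibre_const (c : fchart pi) (q : Pi pi) (z w : J1 pi) :
  semiregular Lhat -> dom (mom_chart c) q -> Lhat z = q -> Lhat w = q ->
  lag_energy (mom_coord q c) c w = lag_energy (mom_coord q c) c z.
Proof.
move=> semL cq zq wq.
have [|conn [k _ sub]] := semL q; first by exists z.
apply: (connected_locally_const conn _ zq wq) => x xq.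
have [a [sa ax slice]] := sub x xq.
exact: (energy_slice_const cq sa slice ax xq).
Qed.

(* Read in [jet_chart c], the morphism [Lhat] is extended by 0, so its Jacobian
   is meaningful only if the image of the chart is a neighbourhood; a submanifold
   chart of the fibre, given by semiregularity, provides this. *)
Lemma legendre_jacobian_base (c : fchart pi) (z : J1 pi) p
    (V : 'M[R]_(p, n + m + n * m)) :
  semiregular Lhat -> dom (jet_chart c) z ->
  lsubmx (V *m 'J (inchart (jet_chart c) (fun w => crd (mom_chart c) (Lhat w)))
                  (crd (jet_chart c) z)) = lsubmx V.
Proof.
move=> semL cz.
pose jc : @chart R (J1 pi) (n + m + n * m) := jet_chart c.
have jci : {in dom jc &, injective (crd jc)} := @jet_chart_inj _ _ _ _ _ _ manX manY c.
have Lz : constraint_space Lhat (Lhat z) by exists z.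
have [_ [k _ sub]] := semL _ Lz; have [a [[ca sa] az _]] := sub z erefl.
have nz : \forall w \near z, dom jc w.
  by apply: open_nbhs_nbhs; split; [exact: jet_chart_open|].
have ajc := sa jc (ex_intro _ c erefl).
have img := compatible_image_nbhs ca jci ajc az nz.
set f := inchart _ (fun w => _).
pose F := inchart jc (coef L (fX c)).
(* The momentum block is written with differentials of [F], so that second order smoothness of the
   Lagrangian yields differentiability of [f]. *)
have fE : {near crd jc z, (fun x => row_mx (lsubmx x) (mxvec (\matrix_(l, i)
    'd F x (row_mx 0 (mxvec (delta_mx l i)))))) =1 f}.
  apply: filterS img => x [w jw <-].
  rewrite /f (inchartE _ jci jw) /=; congr row_mx.
    by rewrite legL.1; exact: row_mxKl.
  rewrite (legL.2 _ _ jw); congr mxvec; apply/matrixP => l i; rewrite !mxE.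
  rewrite deriveE //.
  by apply: smooth_on_differentiable (lagrangian_smooth c) _; exists w.
have df : differentiable f (crd jc z).
  suff dg : differentiable (fun x => row_mx (lsubmx x) (mxvec (\matrix_(l, i)
      'd F x (row_mx 0 (mxvec (delta_mx l i)))))) (crd jc z).
    by have [] := near_eq_is_diff fE (differentiableP dg).
  apply: differentiable_rV => j; case: (split_ordP j) => [j' ->|j' ->].
    under eq_fun do rewrite row_mxEl mxE.
    exact: differentiable_coord.
  case/mxvec_indexP: j' => l i.
  under eq_fun do rewrite row_mxEr mxvecE mxE.
  by apply: smooth_on_differentiable_diff (lagrangian_smooth c) _; exists z.
(* [Lhat] is over [Y]: the base block of [f] is the projection, and its differential is computed in
   two ways. *)
have lE : {near crd jc z, (lsubmx : 'rV_(n + m + n * m) -> 'rV_(n + m)) =1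
    (lsubmx : 'rV_(n + m + n * m) -> 'rV_(n + m)) \o f}.
  by apply: filterS fE => x /= <-; rewrite row_mxKl.
have [_ d1] := near_eq_is_diff lE (linear_is_diff _ (linearP lsubmx)).
have [_ d2] := is_diff_comp (differentiableP df)
  (linear_is_diff (f (crd jc z)) (linearP (@lsubmx R 1 (n + m) (n * m)))).
apply/row_matrixP => k'.
rewrite 2!row_lsubmx row_mul /jacobian mul_rV_lin1.
exact (congr1 (@^~ (row k' V)) (etrans (esym d2) d1)).
Qed.

End Legendre.

(** * Forms that see only the components along [Y] *)

Section Forms.
Context {R : realType} {n m : nat}.

(** Reduces the pullback to the base block of the Jacobian of [Lhat]. *)
Lemma theta_lsubmx (p : 'M[R]_(n, m)) (V W : 'M[R]_(n, n + m + n * m)) :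
  lsubmx V = lsubmx W -> theta p V = theta p W.
Proof. by move=> VW; rewrite /theta /dy_omega VW. Qed.

Lemma vol_lsubmx (V W : 'M[R]_(n, n + m + n * m)) :
  lsubmx V = lsubmx W -> vol V = vol W.
Proof. by move=> VW; rewrite /vol VW. Qed.

Lemma vol_frame : vol (row_mx (row_mx 1%:M 0) 0 : 'M[R]_(n, n + m + n * m)) = 1.
Proof. by rewrite /vol !row_mxKl det1. Qed.

End Forms.

(** * Associated Hamiltonian forms and the energy *)

Section Hamiltonian.
Context {R : realType} {n m : nat} {X : @charted R n} {Y : @charted R (n + m)}.
Variable pi : Y -> X.
Hypotheses (manX : manifold X) (manY : manifold Y).
Variables (L : lagrangian pi) (Lhat : J1 pi -> Pi pi).
Hypotheses (legL : legendre_morphism L Lhat) (semL : semiregular Lhat).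

Lemma associated_ham_energy (H : hamiltonian_form pi) (c : fchart pi)
    (z : J1 pi) :
  associated L Lhat H -> dom (jet_chart c) z ->
  ham H c (Lhat z) = lag_energy L (lag_momentum L c z) c z.
Proof.
move=> [Hhat [_ LH HL]] cz.
have cq : dom (mom_chart c) (Lhat z) by rewrite /= legL.1.
(* Evaluation on a frame of volume 1 turns the equality of forms into one of coefficients: [ham H c]
   at [Lhat z] is the energy at [Hhat (Lhat z)], a point of the same fibre as [z]. *)
have := HL c _ cq (row_mx (row_mx 1%:M 0) 0).
rewrite /ham_form /morphism_form vol_frame !mulr1 -addrA => /addrI.
move=> /(congr1 -%R); rewrite opprK opprD opprK => ->.
rewrite -(legL.2 _ _ cz).
apply: (energy_fibre_const manX manY legL semL cq erefl).
by apply: LH; exists z.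
Qed.

Lemma pullback_ham_form (H : hamiltonian_form pi) (c : fchart pi) (z : J1 pi) :
  associated L Lhat H -> dom (jet_chart c) z ->
  pullback Lhat (ham_form H) c z =1 poincare_cartan L c z.
Proof.
move=> assH cz V; rewrite /pullback /ham_form.
have VJ := legendre_jacobian_base manX manY legL V semL cz.
rewrite (theta_lsubmx _ VJ) (vol_lsubmx VJ) (associated_ham_energy assH cz).
by rewrite (legL.2 _ _ cz) /poincare_cartan /lag_energy mulrBl opprB addrA addrAC.
Qed.

End Hamiltonian.

Theorem proposition8 (R : realType) (n m : nat)
  (X : @charted R n) (Y : @charted R (n + m)) (pi : Y -> X)
  (manX : manifold X) (manY : manifold Y) (fibY : fibred_manifold pi)
  (L : lagrangian pi) (Lhat : J1 pi -> Pi pi)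
  (legL : legendre_morphism L Lhat) (semL : semiregular Lhat) :
  (forall H H' : hamiltonian_form pi,
     associated L Lhat H -> associated L Lhat H' ->
     forall (c : fchart pi) (q : Pi pi),
       constraint_space Lhat q -> dom (mom_chart c) q ->
       ham_form H c q =1 ham_form H' c q /\ ham H c q = ham H' c q) /\
  (forall H : hamiltonian_form pi, associated L Lhat H ->
     forall (c : fchart pi) (z : J1 pi), dom (jet_chart c) z ->
       pullback Lhat (ham_form H) c z =1 poincare_cartan L c z /\
       mom_contract (lag_momentum L c z) (jet_coord c z) - coef L (fX c) z
         = ham H c (Lhat z)).
Proof.
have hamE := associated_ham_energy manX manY legL semL.
split=> [H H' assH assH' c q [z _ <-] cq|H assH c z cz]; last first.
  by split; [exact: pullback_ham_form|rewrite hamE].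
have cz : dom (jet_chart c) z by rewrite /= -legL.1.
(* Both sides are the energy at [z], an expression in [L] alone. *)
have HH' : ham H c (Lhat z) = ham H' c (Lhat z) by rewrite !hamE.
by split=> // V; rewrite /ham_form HH'.
Qed.
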